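(* Let $N\ge1$ and $G=\sum_{n=1}^N\hat X_n$ on $\mathcal{H}=(\mathbb{C}^2)^{\otimes N}$. For a triple $c=(S_+,S_-,T)$ of pairwise disjoint subsets of $\{1,\dots,N\}$ set $$E_c=\prod_{j\in S_+}E_j^{+}\prod_{j\in S_-}E_j^{-}\prod_{j\in T}\hat X_j,\qquad \omega(c)=|S_+|-|S_-|,\qquad m(c)=|S_+|+|S_-|.$$ Then $\mathrm{ad}_G(E_c)=-2\,\omega(c)\,E_c$ for every such $c$, and the $4^N$ operators $\{E_c\}$ form an orthogonal basis of $\mathcal{B}(\mathcal{H})$. Moreover, for every $c$ with $\omega=\omega(c)>0$, the operators $\mathcal{X}_c=E_c+E_c^\dagger$ and $\mathcal{Y}_c=\tfrac1i(E_c-E_c^\dagger)$ are Hermitian and satisfy $$[G,\mathcal{X}_c]=-2i\omega\,\mathcal{Y}_c,\qquad [G,\mathcal{Y}_c]=2i\omega\,\mathcal{X}_c,\qquad \|\mathcal{X}_c\|^2=\|\mathcal{Y}_c\|^2=2^{m(c)+1}.$$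
   Context: $\mathcal{B}(\mathcal{H})$ is the space of linear operators on $\mathcal{H}=(\mathbb{C}^2)^{\otimes N}$ with inner product $\langle A,B\rangle=2^{-N}\mathrm{Tr}(A^\dagger B)$ and induced norm $\|A\|^2=\langle A,A\rangle$. $X,Y,Z$ are the Pauli matrices; for a single-qubit operator $A$, $\hat A_n=I^{\otimes(n-1)}\otimes A\otimes I^{\otimes(N-n)}$. $E_j^{\pm}=\hat Z_j\pm i\hat Y_j$. $\mathrm{ad}_G(A)=[G,A]=GA-AG$. Subsets may be empty, and empty products are the identity. *)

(* Defs.v *)
From HB Require Import structures.
From mathcomp Require Import all_boot all_order all_algebra.
From mathcomp Require Import mxtens.

Set Implicit Arguments.
Unset Strict Implicit.
Unset Printing Implicit Defensive.

Import GRing.Theory Num.Theory.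
Local Open Scope ring_scope.

(* Operators on (C^2)^{(x) N} are the matrices 'M[C]_(2 ^ N) in the
   computational (Kronecker) basis; A * B is the matrix product *m, through the
   (possibly trivial) ring structure of 'M_n. Qubits are numbered from 0. *)

Section Operators.
Variable C : numClosedFieldType.

Definition adjoint n (A : 'M[C]_n) : 'M[C]_n := map_mx Num.conj A^T.

Definition ad n (G A : 'M[C]_n) : 'M[C]_n := G * A - A * G.

Definition hs_inner N (A B : 'M[C]_(2 ^ N)) : C :=
  2 ^- N * \tr (adjoint A * B).

Definition hs_norm N (A : 'M[C]_(2 ^ N)) : C := sqrtC (hs_inner A A).

Definition pauliX : 'M[C]_2 := delta_mx 0 1 + delta_mx 1 0.
Definition pauliY : 'M[C]_2 := 'i *: (delta_mx 1 0 - delta_mx 0 1).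
Definition pauliZ : 'M[C]_2 := delta_mx 0 0 - delta_mx 1 1.

Lemma site_dim N (n : 'I_N) : (2 ^ n * 2 * 2 ^ (N - n.+1) = 2 ^ N)%N.
Proof. by rewrite -expnSr -expnD subnKC. Qed.

(* There are n identity factors on the left of A
   and N - n.+1 on its right. *)
Definition site N (A : 'M[C]_2) (n : 'I_N) : 'M[C]_(2 ^ N) :=
  castmx (site_dim n, site_dim n)
    (tensmx (tensmx (ntensmx 1%:M n) A) (ntensmx 1%:M (N - n.+1))).

Definition Eplus N (j : 'I_N) : 'M[C]_(2 ^ N) :=
  site pauliZ j + 'i *: site pauliY j.
Definition Eminus N (j : 'I_N) : 'M[C]_(2 ^ N) :=
  site pauliZ j - 'i *: site pauliY j.

Definition generator N : 'M[C]_(2 ^ N) := \sum_(n < N) site pauliX n.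

End Operators.

Arguments generator : clear implicits.

Definition pairwise_disjoint N
    (S : {set 'I_N} * {set 'I_N} * {set 'I_N}) : bool :=
  [&& [disjoint S.1.1 & S.1.2], [disjoint S.1.1 & S.2]
    & [disjoint S.1.2 & S.2]].

Record triple N := Triple {
  triple_val : {set 'I_N} * {set 'I_N} * {set 'I_N};
  _ : pairwise_disjoint triple_val
}.

HB.instance Definition _ N := [isSub for @triple_val N].
HB.instance Definition _ N := [Finite of triple N by <:].

Definition Splus N (c : triple N) : {set 'I_N} := (triple_val c).1.1.
Definition Sminus N (c : triple N) : {set 'I_N} := (triple_val c).1.2.
Definition Tset N (c : triple N) : {set 'I_N} := (triple_val c).2.

Definition omega N (c : triple N) : int := #|Splus c|%:Z - #|Sminus c|%:Z.
Definition mdeg N (c : triple N) : nat := (#|Splus c| + #|Sminus c|)%N.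

Section Strings.
Variables (C : numClosedFieldType) (N : nat).

(* The factors of each product commute; big products take them in increasing
   order of the index. *)
Definition Estring (c : triple N) : 'M[C]_(2 ^ N) :=
  (\prod_(j in Splus c) Eplus C j) * (\prod_(j in Sminus c) Eminus C j)
  * (\prod_(j in Tset c) site (pauliX C) j).

Definition Xstring (c : triple N) : 'M[C]_(2 ^ N) :=
  Estring c + adjoint (Estring c).
Definition Ystring (c : triple N) : 'M[C]_(2 ^ N) :=
  'i^-1 *: (Estring c - adjoint (Estring c)).

End Strings.

(* Main.v *)
(* In the computational basis the entries of a product operator are products
   of the entries of its factors over the binary digits of the indices, so
   products, adjoints, traces and Hilbert-Schmidt inner products of product
   operators are computed factor by factor. Each E_c is a product operator with
   factors among Z + iY, Z - iY, X and 1, which are orthogonal eigenvectors of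
   [X, .] with eigenvalues -2, 2, 0, 0; eigenvalues add up over the sites, and
   4^N nonzero orthogonal vectors form a basis. The adjoint exchanges
   S_+ and S_-, so for omega(c) <> 0 it sends E_c to an orthogonal string with
   the opposite eigenvalue, from which the claims on X_c and Y_c follow. *)
Require Import Defs.
From mathcomp Require Import all_boot all_order all_algebra.
From mathcomp Require Import complex reals mxtens zify ring.

Set Implicit Arguments.
Unset Strict Implicit.
Unset Printing Implicit Defensive.

Import GRing.Theory Num.Theory.
Local Open Scope ring_scope.

(** * Binary digits of basis indices *)

Lemma eqn_mod_digits a (i j : nat) :
  (forall k, (k < a)%N -> i %/ 2 ^ k = j %/ 2 ^ k %[mod 2])%N
  <-> (i = j %[mod 2 ^ a])%N.
Proof.
(* Bit [k] of a number is the top bit of its residue modulo [2 ^ k.+1]. *)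
have low k : (i %/ 2 ^ k = j %/ 2 ^ k %[mod 2])%N
    <-> ((i %% 2 ^ k.+1) %/ 2 ^ k = (j %% 2 ^ k.+1) %/ 2 ^ k)%N.
  by rewrite expnS -!modn_divl.
split=> [|eq_ij k lt_ka].
  elim: a => [|a IHa] eq_d; first by rewrite !modn1.
  have /low eq_hi := eq_d a (ltnSn a).
  have eq_lo: (i = j %[mod 2 ^ a])%N by apply: IHa => k /ltnW /eq_d.
  have dvd_a : (2 ^ a %| 2 ^ a.+1)%N by rewrite dvdn_exp2l.
  rewrite (divn_eq (i %% _) (2 ^ a)) (divn_eq (j %% _) (2 ^ a)) eq_hi.
  by rewrite !(modn_dvdm _ dvd_a) eq_lo.
have dvd_k : (2 ^ k.+1 %| 2 ^ a)%N by rewrite dvdn_exp2l.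
by apply/low; rewrite -(modn_dvdm i dvd_k) -(modn_dvdm j dvd_k) eq_ij.
Qed.

Section Digits.
Variable N : nat.

(* Qubit [0] is the most significant bit of a basis index. *)
Definition digit (i : 'I_(2 ^ N)) (n : 'I_N) : 'I_2 :=
  inZp (i %/ 2 ^ (N - n.+1)).

Lemma digit_eq (i j : 'I_(2 ^ N)) n : (digit i n = digit j n)
  <-> (i %/ 2 ^ (N - n.+1) = j %/ 2 ^ (N - n.+1) %[mod 2])%N.
Proof. by split=> [[]|eq_ij] //; apply: val_inj. Qed.

Definition digits (i : 'I_(2 ^ N)) : {ffun 'I_N -> 'I_2} := [ffun n => digit i n].

(** An index below [2 ^ N] is determined by its [N] bits, and both sides have [2 ^ N] elements. *)
Lemma digits_bij : bijective digits.
Proof.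
apply: inj_card_bij; last by rewrite card_ffun !card_ord.
move=> i j /ffunP eq_ij; apply: val_inj => /=.
rewrite -(modn_small (ltn_ord i)) -(modn_small (ltn_ord j)).
(* Bit [k] belongs to qubit [N - k.+1], hence [rev_ord]. *)
apply/eqn_mod_digits => k lt_kN; have := eq_ij (rev_ord (Ordinal lt_kN)).
by rewrite !ffunE => /digit_eq /=; rewrite subnSK // subKn // ltnW.
Qed.

(** Qubit [n] sits at bit [b]. The right side is the form in which the two identity blocks of [site]
    compare indices: the bits above [b], then the bits below it. *)
Lemma eq_other_digits (n : 'I_N) (i j : 'I_(2 ^ N)) (b := (N - n.+1)%N) :
  [forall (m | m != n), digit i m == digit j m]
  = (i %/ 2 ^ b %/ 2 == j %/ 2 ^ b %/ 2)%N && (i == j %[mod 2 ^ b])%N.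
Proof.
(* The high part has only [n] bits, so comparing it modulo [2 ^ n] loses nothing. *)
have lt_n (k : 'I_(2 ^ N)) : (k %/ 2 ^ b %/ 2 < 2 ^ n)%N.
  by rewrite !ltn_divLR ?expn_gt0 // (site_dim n).
apply/forall_inP/andP=>
    [eq_ij | [/eqP eq_hi /eqP/eqn_mod_digits eq_lo] m ne_mn].
  have eq_d k : (k < N)%N -> k != b ->
      (i %/ 2 ^ k = j %/ 2 ^ k %[mod 2])%N.
    move=> lt_kN ne_kb; have := eq_ij (rev_ord (Ordinal lt_kN)).
    have ne_rev : rev_ord (Ordinal lt_kN) != n.
      by apply: contraNneq ne_kb => eq_n; rewrite /b -eq_n /=; lia.
    move=> /(_ ne_rev) /eqP/digit_eq /=.
    by rewrite subnSK // subKn // ltnW.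
  split; apply/eqP.
    rewrite -(modn_small (lt_n i)) -(modn_small (lt_n j)).
    apply/eqn_mod_digits => k lt_kn; rewrite -!divnMA -expnS -expnD.
    by apply: eq_d; rewrite /b; have := ltn_ord n; lia.
  by apply/eqn_mod_digits => k lt_kb; apply: eq_d; lia.
apply/eqP/digit_eq; have [lt_mn | le_nm] := ltnP m n.
  have -> : (N - m.+1 = b + (n - m.+1).+1)%N by have := ltn_ord n; lia.
  by rewrite expnD expnS mulnA !divnMA eq_hi.
apply: eq_lo; have := ltn_ord m.
have : m != n :> nat by [].
by rewrite /b; lia.
Qed.
End Digits.

(** * Product operators, computed site by site *)

Section ProductOperators.
Variables (C : numClosedFieldType) (N : nat).
Implicit Types A B : 'I_N -> 'M[C]_2.

(** The tensor product of the [A n], given by its entries so that no cast between dimensions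
    occurs. *)
Definition ptens A : 'M[C]_(2 ^ N) :=
  \matrix_(i, j) \prod_n A n (digit i n) (digit j n).

Lemma eq_ptens A B : A =1 B -> ptens A = ptens B.
Proof.
move=> eqAB; apply/matrixP=> i j; rewrite !mxE.
by apply: eq_bigr=> n _; rewrite eqAB.
Qed.

(** Expanding a product of sums over sites yields a sum over digit strings; this turns it back into
    a sum over basis indices. *)
Lemma reindex_digits (F : {ffun 'I_N -> 'I_2} -> C) :
  \sum_f F f = \sum_i F (digits i).
Proof. exact/reindex/onW_bij/digits_bij. Qed.

Lemma ptensM A B : ptens A * ptens B = ptens (fun n => A n * B n).
Proof.
apply/matrixP=> i j; rewrite !mxE.
under [RHS]eq_bigr do rewrite mxE.
rewrite bigA_distr_bigA reindex_digits; apply: eq_bigr => k _.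
by rewrite !mxE -big_split; apply: eq_bigr => n _; rewrite ffunE.
Qed.

Lemma ptens1 : ptens (fun=> 1) = 1.
Proof.
apply/matrixP=> i j; rewrite !mxE; under eq_bigr do rewrite mxE.
case: eqVneq => [-> | ne_ij]; first by rewrite big1 // => n _; rewrite eqxx.
have [n ne_n] : exists n, digit i n != digit j n.
  apply/existsP; rewrite -negb_forall; apply: contra_neqN ne_ij => /forallP eq_ij.
  by apply: (bij_inj (digits_bij N)); apply/ffunP=> n; rewrite !ffunE; apply/eqP.
by rewrite (bigD1 n) //= (negPf ne_n) mul0r.
Qed.

Lemma tr_ptens A : \tr (ptens A) = \prod_n \tr (A n).
Proof.
rewrite bigA_distr_bigA reindex_digits; apply: eq_bigr => i _; rewrite mxE.
by apply: eq_bigr => n _; rewrite ffunE.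
Qed.

Lemma adjoint_ptens A : adjoint (ptens A) = ptens (fun n => adjoint (A n)).
Proof.
apply/matrixP=> i j; rewrite !mxE rmorph_prod.
by apply: eq_bigr => n _; rewrite !mxE.
Qed.

(** The normalisation [2 ^- N] splits into one factor [2^-1] per site. *)
Lemma hs_inner_ptens A B :
  hs_inner (ptens A) (ptens B) = \prod_n (2^-1 * \tr (adjoint (A n) * B n)).
Proof.
rewrite /hs_inner adjoint_ptens ptensM tr_ptens big_split.
by rewrite prodr_const card_ord exprVn.
Qed.

Lemma ntensmx_id (k : nat) : ntensmx (1%:M : 'M[C]_2) k = 1%:M.
Proof.
case: k => [|k] //; rewrite /ntensmx; elim: k => //= k ->.
apply/matrixP=> i j; rewrite !mxE -natrM mulnb; congr (_%:R).
by rewrite -xpair_eqE (can_eq (@mxtens_unindexK _ _)).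
Qed.

(** The identity blocks kill every entry whose row and column differ in a digit other than the
    [n]-th. *)
Lemma siteE (M : 'M[C]_2) (n : 'I_N) i j :
  site M n i j = M (digit i n) (digit j n)
    *+ [forall (m | m != n), digit i m == digit j m].
Proof.
rewrite castmxE !mxE !ntensmx_id !mxE eq_other_digits -!val_eqE /=.
case: (_ %/ _ %/ 2 == _)%N; case: (_ == _ %[mod _])%N;
  rewrite ?mulr0 ?mul0r ?mulr1 ?mul1r //.
by congr (M _ _); apply: val_inj.
Qed.

Lemma site_linear (n : 'I_N) a (M M' : 'M[C]_2) :
  site (a *: M + M') n = a *: site M n + site M' n.
Proof. by apply/matrixP=> i j; rewrite !mxE !siteE !mxE mulrnDl mulrnAr. Qed.

Lemma site_ptens (M : 'M[C]_2) (n : 'I_N) :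
  site M n = ptens (fun m => if m == n then M else 1).
Proof.
apply/matrixP=> i j; rewrite siteE mxE (bigD1 n) //= eqxx -mulr_natr.
congr (_ * _); case: forall_inP => [eq_ij | ne_ij].
  by rewrite big1 // => m ne_mn; rewrite (negPf ne_mn) mxE eq_ij.
have /forall_inPn[m ne_mn ne_m] :
    ~~ [forall (m | m != n), digit i m == digit j m].
  exact/forall_inP.
by rewrite (bigD1 m) //= (negPf ne_mn) mxE (negPf ne_m) mul0r.
Qed.

Lemma prod_ptens (I : Type) (r : seq I) (P : pred I) (F : I -> 'I_N -> 'M[C]_2) :
  \prod_(j <- r | P j) ptens (F j) = ptens (fun n => \prod_(j <- r | P j) F j n).
Proof.
elim: r => [|j r IHr].
  by rewrite big_nil -ptens1; apply: eq_ptens => n; rewrite big_nil.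
rewrite big_cons IHr; case: ifP => Pj; rewrite ?ptensM; apply: eq_ptens => n;
  by rewrite big_cons Pj.
Qed.

(** At site [n] only the factor with [j = n] can differ from the identity. *)
Lemma prod_site (S : {set 'I_N}) (M : 'M[C]_2) :
  \prod_(j in S) site M j = ptens (fun n => if n \in S then M else 1).
Proof.
under eq_bigr do rewrite site_ptens.
rewrite prod_ptens; apply: eq_ptens => n; case: ifP => [Sn | nSn]; last first.
  by rewrite big1 // => j Sj; case: eqP nSn => // ->; rewrite Sj.
by rewrite (big_only1 n) ?eqxx // => j ne_jn _; rewrite eq_sym (negPf ne_jn).
Qed.

(** Away from site [n] both products in the commutator have the factors of [A], which come out in
    front of the commutator at site [n]. *)
Lemma ad_site_ptens (M : 'M[C]_2) (n : 'I_N) A a :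
  ad M (A n) = a *: A n -> ad (site M n) (ptens A) = a *: ptens A.
Proof.
move=> /matrixP adA; rewrite /ad site_ptens !ptensM.
apply/matrixP=> i j; rewrite !mxE !(bigD1 n (P := predT)) //= eqxx.
have eqL : \prod_(m < N | m != n)
    ((if m == n then M else 1) * A m) (digit i m) (digit j m)
    = \prod_(m < N | m != n) A m (digit i m) (digit j m).
  by apply: eq_bigr => m /negPf->; rewrite mul1r.
have eqR : \prod_(m < N | m != n)
    (A m * (if m == n then M else 1)) (digit i m) (digit j m)
    = \prod_(m < N | m != n) A m (digit i m) (digit j m).
  by apply: eq_bigr => m /negPf->; rewrite mulr1.
rewrite eqL eqR -mulrBl mulrA; congr (_ * _).
by have := adA (digit i n) (digit j n); rewrite !mxE.
Qed.

End ProductOperators.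

(** * Sesquilinearity of the inner product, linearity of [ad], Hermitian matrices *)

Section HilbertSchmidt.
Variables (C : numClosedFieldType) (N : nat).
Implicit Types A B D : 'M[C]_(2 ^ N).

Lemma adjoint_linear n a (A B : 'M[C]_n) :
  adjoint (a *: A + B) = a^* *: adjoint A + adjoint B.
Proof. by apply/matrixP=> i j; rewrite !mxE rmorphD rmorphM. Qed.

Lemma hs_inner_linearr A a B D :
  hs_inner A (a *: B + D) = a * hs_inner A B + hs_inner A D.
Proof.
rewrite /hs_inner mulrDr -[X in X + _]/(_ *m _) -scalemxAr mxtraceD mxtraceZ.
by rewrite mulrDr mulrCA.
Qed.

Lemma hs_inner_linearl A a B D :
  hs_inner (a *: B + D) A = a^* * hs_inner B A + hs_inner D A.
Proof.
rewrite /hs_inner adjoint_linear mulrDl -[X in X + _]/(_ *m _) -scalemxAl.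
by rewrite mxtraceD mxtraceZ mulrDr mulrCA.
Qed.

Lemma hs_inner0r A : hs_inner A 0 = 0.
Proof. by rewrite /hs_inner mulr0 mxtrace0 mulr0. Qed.

Lemma hs_inner0l A : hs_inner 0 A = 0.
Proof.
have -> : hs_inner 0 A = 2 ^- N * \tr ((0 : 'M[C]_(2 ^ N)) * A).
  by congr (_ * \tr (_ * _)); apply/matrixP=> i j; rewrite !mxE conjC0.
by rewrite mul0r mxtrace0 mulr0.
Qed.

Lemma hs_inner_sumr (I : Type) (r : seq I) (P : pred I) A (k : I -> C)
    (F : I -> 'M[C]_(2 ^ N)) :
  hs_inner A (\sum_(i <- r | P i) k i *: F i)
  = \sum_(i <- r | P i) k i * hs_inner A (F i).
Proof.
elim: r => [|i r IHr]; first by rewrite !big_nil hs_inner0r.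
by rewrite !big_cons; case: ifP => _ //; rewrite hs_inner_linearr IHr.
Qed.

(** Pythagoras; it gives the norms of both quadratures. *)
Lemma hs_inner_orthoD A B (x y : C) :
  hs_inner A B = 0 -> hs_inner B A = 0 ->
  hs_inner (x *: A + y *: B) (x *: A + y *: B)
  = `|x| ^+ 2 * hs_inner A A + `|y| ^+ 2 * hs_inner B B.
Proof.
move=> AB0 BA0; have -> : y *: B = y *: B + 0 by rewrite addr0.
rewrite !hs_inner_linearl !hs_inner_linearr AB0 BA0 !hs_inner0r !hs_inner0l.
rewrite !normCK; ring.
Qed.

Lemma ad_linear n (G A B : 'M[C]_n) a : ad G (a *: A + B) = a *: ad G A + ad G B.
Proof.
rewrite /ad -![G * _]/(G *m _) -![_ * G]/(_ *m G) mulmxDr mulmxDl.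
by rewrite -scalemxAr -scalemxAl scalerBr opprD addrACA.
Qed.

Lemma hermsymm_adjoint n (A : 'M[C]_n) : adjoint A = A -> A \is hermsymmx.
Proof.
move=> adjA; apply/is_hermitianmxP; rewrite expr0 scale1r -[LHS]adjA.
by apply/matrixP=> i j; rewrite !mxE.
Qed.

End HilbertSchmidt.

(** * Hermitian quadratures of an eigenvector of [ad G] *)

Section Quadratures.
Variables (C : numClosedFieldType) (n : nat) (G E : 'M[C]_n) (w : C).
Let X := E + adjoint E.
Let Y := 'i^-1 *: (E - adjoint E).
Hypotheses (adE : ad G E = (- (2 * w)) *: E)
           (adE' : ad G (adjoint E) = (2 * w) *: adjoint E).

Let XE : X = 1 *: E + 1 *: adjoint E. Proof. by rewrite !scale1r. Qed.

Let YE : Y = 'i^-1 *: E + (- 'i^-1) *: adjoint E.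
Proof. by rewrite scaleNr -scalerBr. Qed.

(** On combinations of [E] and its adjoint, [ad G] acts diagonally; [X] and [Y] are two such
    combinations. *)
Let ad_comb a b : ad G (a *: E + b *: adjoint E)
  = (- (2 * w * a)) *: E + (2 * w * b) *: adjoint E.
Proof.
rewrite ad_linear -[b *: _]addr0 ad_linear adE adE' /ad mulr0 mul0r subr0 addr0.
by rewrite !scalerA; congr (_ *: _ + _ *: _); ring.
Qed.

Lemma hermsymm_quadratures : X \is hermsymmx /\ Y \is hermsymmx.
Proof.
split; apply: hermsymm_adjoint; apply/matrixP=> i j; rewrite !mxE.
  by rewrite rmorphD /= conjCK addrC.
by rewrite rmorphM rmorphB /= conjCK fmorphV /= conjCi invrN mulNr -mulrN opprB.
Qed.

Lemma ad_quadratures :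
  ad G X = (- (2 * 'i * w)) *: Y /\ ad G Y = (2 * 'i * w) *: X.
Proof.
rewrite XE YE !ad_comb !scalerDr !scalerA invCi.
(* [ring] treats ['i] as a variable, so the relation for its square is supplied as a factor 1 on the
   left side. *)
have iN : - ('i * 'i) = 1 :> C by rewrite -expr2 sqrCi opprK.
split; congr (_ *: _ + _ *: _).
- by rewrite -[LHS]mul1r -{1}iN; ring.
- by rewrite -[LHS]mul1r -{1}iN; ring.
- by ring.
- by ring.
Qed.

End Quadratures.

(** * The four single-qubit factors *)

Section LocalFactors.
Variable C : numClosedFieldType.
Implicit Type l : bool * bool.

(** The first bit marks the factors counted by [mdeg]; with this encoding the adjoint becomes an
    exclusive or of the two bits. *)
Definition local_factor l : 'M[C]_2 :=
  match l with
  | (true, true) => pauliZ C + 'i *: pauliY C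
  | (true, false) => pauliZ C - 'i *: pauliY C
  | (false, true) => pauliX C
  | (false, false) => 1
  end.

Definition charge l : int := if l.1 then (if l.2 then 1 else -1) else 0.

Definition dual_label l := (l.1, l.1 (+) l.2).

(** Removes ['i], so that all four local factors have integer entries and the checks below are ring
    identities. *)
Lemma iY : 'i *: pauliY C = delta_mx 0 1 - delta_mx 1 0.
Proof. by rewrite scalerA -expr2 sqrCi scaleN1r opprB. Qed.

Lemma matrix2P (M M' : 'M[C]_2) :
  [/\ M 0 0 = M' 0 0, M 0 1 = M' 0 1, M 1 0 = M' 1 0 & M 1 1 = M' 1 1] -> M = M'.
Proof.
have ordP (k : 'I_2) : k = 0 \/ k = 1.
  by case: k => [[|[|k]] //= lt_k]; [left | right]; apply: val_inj.
case=> e00 e01 e10 e11; apply/matrixP=> i j.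
by case: (ordP i) => ->; case: (ordP j) => ->.
Qed.

Lemma adjoint_local l : adjoint (local_factor l) = local_factor (dual_label l).
Proof.
by case: l => [[] []]; rewrite /= ?iY; apply: matrix2P; split;
  rewrite !mxE /= ?(rmorphB, rmorphD) /= ?conjC0 ?conjC1; ring.
Qed.

Lemma ad_local l :
  ad (pauliX C) (local_factor l) = (- (2 * (charge l)%:~R)) *: local_factor l.
Proof.
by case: l => [[] []]; rewrite /charge /= ?iY ?rmorphN1; apply: matrix2P; split;
  rewrite !(mxE, big_ord_recl, big_ord0) /=; ring.
Qed.

(** The leading 2 cancels against the normalisation per site, which leaves squared norm 1 for [X]
    and the identity, and 2 for [Z + iY] and [Z - iY]. *)
Lemma gram_local l l' :
  \tr (adjoint (local_factor l) * local_factor l') = 2 * ((l == l')%:R * 2 ^+ l.1).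
Proof.
rewrite adjoint_local /mxtrace.
case: l l' => [[] []] [[] []]; rewrite /= ?iY;
  by rewrite !(mxE, big_ord_recl, big_ord0) /=; ring.
Qed.

End LocalFactors.

(** * Operator strings and their labels *)

Section Strings.
Variables (C : numClosedFieldType) (N : nat).
Implicit Types (c : triple N) (l : 'I_N -> bool * bool).

Definition string_op l : 'M[C]_(2 ^ N) := ptens (fun n => local_factor C (l n)).

Lemma adjoint_string l : adjoint (string_op l) = string_op (dual_label \o l).
Proof. by rewrite adjoint_ptens; apply: eq_ptens => n; rewrite adjoint_local. Qed.

Lemma hs_inner_string l l' :
  hs_inner (string_op l) (string_op l') = \prod_n ((l n == l' n)%:R * 2 ^+ (l n).1).
Proof.
rewrite hs_inner_ptens; apply: eq_bigr => n _.
by rewrite gram_local mulKf ?pnatr_eq0.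
Qed.

Lemma hs_inner_string_eq0 l l' n :
  l n != l' n -> hs_inner (string_op l) (string_op l') = 0.
Proof. by move=> ne_n; rewrite hs_inner_string (bigD1 n) //= (negPf ne_n) !mul0r. Qed.

Lemma hs_inner_stringxx l :
  hs_inner (string_op l) (string_op l) = 2 ^+ (\sum_n (l n).1).
Proof.
by rewrite hs_inner_string -prodrXr; apply: eq_bigr => n _; rewrite eqxx mul1r.
Qed.

Lemma ad_string l :
  ad (generator C N) (string_op l) = (- (2 * (\sum_n charge (l n))%:~R)) *: string_op l.
Proof.
rewrite rmorph_sum mulr_sumr -sumrN scaler_suml /ad mulr_suml mulr_sumr -sumrB.
by apply: eq_bigr => n _; apply/ad_site_ptens/ad_local.
Qed.

(** By disjointness each site lies in exactly one of [Splus c], [Sminus c], [Tset c] and the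
    complement of their union; the two bits tell these four cases apart. *)
Definition label c : {ffun 'I_N -> bool * bool} :=
  [ffun n => (n \in Splus c :|: Sminus c, n \in Splus c :|: Tset c)].

Lemma triple_disjoint c : [/\ [disjoint Splus c & Sminus c],
  [disjoint Splus c & Tset c] & [disjoint Sminus c & Tset c]].
Proof. by case: c => S dS; apply/and3P. Qed.

Lemma labelP c n : [/\ (n \in Splus c) = (label c n == (true, true)),
  (n \in Sminus c) = (label c n == (true, false))
  & (n \in Tset c) = (label c n == (false, true))].
Proof.
have [/disjointFr d1 /disjointFr d2 /disjointFr d3] := triple_disjoint c.
rewrite ffunE !inE.
case Sp: (n \in Splus c); first by rewrite (d1 n) ?(d2 n).
case Sm: (n \in Sminus c); first by rewrite (d3 n).
by case: (n \in Tset c).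
Qed.

Lemma label_inj : injective label.
Proof.
move=> c d eq_cd; apply: val_inj.
have eqS (F : triple N -> {set 'I_N}) v :
    (forall c n, (n \in F c) = (label c n == v)) -> F c = F d.
  by move=> FE; apply/setP=> n; rewrite !FE eq_cd.
rewrite [val c]surjective_pairing [val d]surjective_pairing.
rewrite [(val c).1]surjective_pairing [(val d).1]surjective_pairing.
congr (_, _, _).
- by apply: (eqS (@Splus N) (true, true)) => e n; case: (labelP e n).
- by apply: (eqS (@Sminus N) (true, false)) => e n; case: (labelP e n).
- by apply: (eqS (@Tset N) (false, true)) => e n; case: (labelP e n).
Qed.

Lemma label_surj (f : {ffun 'I_N -> bool * bool}) : exists c, label c = f.
Proof.
pose S v := [set n | f n == v].
have dS v w : v != w -> [disjoint S v & S w].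
  move=> ne_vw; apply/pred0P => n /=; rewrite !inE.
  by case: eqP => // ->; apply: negPf.
have dSSS : pairwise_disjoint (S (true, true), S (true, false), S (false, true)).
  by apply/and3P; split; apply: dS.
exists (Triple dSSS); apply/ffunP=> n; rewrite ffunE !inE /=.
by case: (f n) => [[] []].
Qed.

Lemma label_bij : bijective label.
Proof.
have ex f : exists c, label c == f by have [c <-] := label_surj f; exists c.
exists (fun f => xchoose (ex f)) => [c | f]; last exact/eqP/(xchooseP (ex f)).
exact/label_inj/eqP/(xchooseP (ex _)).
Qed.

Lemma card_triple : #|{: triple N}| = (4 ^ N)%N.
Proof. by rewrite (bij_eq_card label_bij) card_ffun card_prod card_bool card_ord. Qed.

Lemma EstringE c : Estring C c = string_op (label c).
Proof.
have Ep j : Eplus C j = site (local_factor C (true, true)) j.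
  (* The first [addrC] puts the scaled term first, as [site_linear] expects; the second restores the
     order. *)
  by rewrite /Eplus addrC -site_linear addrC.
have Em j : Eminus C j = site (local_factor C (true, false)) j.
  by rewrite /Eminus addrC -scaleNr -site_linear scaleNr addrC.
rewrite /Estring; under eq_bigr do rewrite Ep.
under [X in _ * X * _]eq_bigr do rewrite Em.
rewrite !prod_site !ptensM; apply: eq_ptens => n.
have [-> -> ->] := labelP c n.
by case: (label c n) => [[] []]; rewrite /= ?mulr1 ?mul1r.
Qed.

Lemma sum_charge c : \sum_n charge (label c n) = omega c.
Proof.
have cardZ (S : {set 'I_N}) : #|S|%:Z = \sum_n (n \in S)%:Z.
  rewrite -sum1_card big_mkcond (big_morph Posz PoszD erefl).
  by apply: eq_bigr => n _; case: ifP.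
rewrite /omega !cardZ -sumrB; apply: eq_bigr => n _.
by have [-> -> _] := labelP c n; case: (label c n) => [[] []].
Qed.

Lemma sum_mdeg c : (\sum_n (label c n).1 = mdeg c)%N.
Proof.
have cardN (S : {set 'I_N}) : #|S| = (\sum_n (n \in S))%N.
  by rewrite -sum1_card big_mkcond; apply: eq_bigr => n _; case: ifP.
rewrite /mdeg !cardN -big_split /=.
apply: eq_bigr => n _; have [-> -> _] := labelP c n.
by case: (label c n) => [[] []].
Qed.

Lemma basis_Estring : basis_of fullv [seq Estring C c | c : triple N].
Proof.
rewrite basisEfree subvf dimvf dim_matrix size_image card_triple.
(* The dimension [2 ^ N * 2 ^ N] equals the number of strings, so only freeness remains. *)
rewrite [X in (X <= _)%N](_ : _ = 4 ^ N)%N; last by rewrite -[4%N]/(2 * 2)%N expnMn.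
rewrite leqnn !andbT.
apply/(freeP (X := codom_tuple (Estring C (N := N)))) => k.
under eq_bigr do rewrite nth_codom EstringE.
(* Pairing the vanishing combination with the [i]-th string isolates its coefficient, multiplied by
   a power of 2. *)
move=> /(congr1 (fun M => hs_inner _ M)) sum0 i.
have := sum0 (string_op (label (enum_val i))).
rewrite hs_inner_sumr (bigD1 i) //= big1 => [|j ne_ji]; last first.
  have [n ne_n] : exists n, label (enum_val i) n != label (enum_val j) n.
    apply/existsP; rewrite -negb_forall; apply: contra_neqN ne_ji => /forallP eq_ij.
    by apply/enum_val_inj/label_inj/ffunP=> n; apply/esym/eqP.
  by rewrite (hs_inner_string_eq0 ne_n) mulr0.
rewrite addr0 hs_inner_stringxx /hs_inner mulr0 mxtrace0 mulr0 => /eqP.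
by rewrite mulf_eq0 expf_eq0 pnatr_eq0 andbF orbF => /eqP.
Qed.

(** A nonzero total charge needs a site whose first bit is set, and there the dual label differs. *)
Lemma string_dual_ortho l : \sum_n charge (l n) != 0 ->
  hs_inner (string_op l) (string_op (dual_label \o l)) = 0
  /\ hs_inner (string_op (dual_label \o l)) (string_op l) = 0.
Proof.
move=> nz_l; have [n ln] : exists n, (l n).1.
  apply/existsP; apply: contraNT nz_l; rewrite negb_exists => /forallP l0.
  by rewrite big1 // => n _; rewrite /charge (negPf (l0 n)).
have ne_n : l n != dual_label (l n) by case: (l n) ln => [[] []].
split; apply: (@hs_inner_string_eq0 _ _ n) => /=; first exact: ne_n.
by rewrite eq_sym.
Qed.

Lemma sum_charge_dual l :
  \sum_n charge (dual_label (l n)) = - \sum_n charge (l n).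
Proof. by rewrite -sumrN; apply: eq_bigr => n _; case: (l n) => [[] []]. Qed.

End Strings.

Theorem proposition2 (R : realType) (N : nat) (N_ge1 : (1 <= N)%N) :
  let G := generator R[i] N in
  [/\ forall c : triple N,
        ad G (Estring R[i] c) = (- (2 * (omega c)%:~R)) *: Estring R[i] c,
      [/\ #|{: triple N}| = (4 ^ N)%N,
          forall c d : triple N,
            c != d -> hs_inner (Estring R[i] c) (Estring R[i] d) = 0
        & basis_of fullv [seq Estring R[i] c | c : triple N]]
    & forall c : triple N, 0 < omega c ->
        [/\ Xstring R[i] c \is hermsymmx, Ystring R[i] c \is hermsymmx,
            ad G (Xstring R[i] c)
              = (- (2 * 'i * (omega c)%:~R)) *: Ystring R[i] c,
            ad G (Ystring R[i] c)
              = (2 * 'i * (omega c)%:~R) *: Xstring R[i] c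
          & hs_norm (Xstring R[i] c) ^+ 2 = 2 ^+ (mdeg c).+1
            /\ hs_norm (Ystring R[i] c) ^+ 2 = 2 ^+ (mdeg c).+1]].
Proof.
move=> G; have adE c :
    ad G (Estring R[i] c) = (- (2 * (omega c)%:~R)) *: Estring R[i] c.
  by rewrite EstringE ad_string sum_charge.
split=> //; first split; [exact: card_triple | | exact: basis_Estring |].
  move=> c d ne_cd; rewrite !EstringE.
  have [n ne_n] : exists n, label c n != label d n.
    apply/existsP; rewrite -negb_forall; apply: contra_neqN ne_cd => /forallP eq_cd.
    by apply/label_inj/ffunP=> n; apply/eqP.
  exact: hs_inner_string_eq0 ne_n.
move=> c w_gt0.
have adE' : ad G (adjoint (Estring R[i] c))
    = (2 * (omega c)%:~R) *: adjoint (Estring R[i] c).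
  rewrite EstringE adjoint_string ad_string sum_charge_dual sum_charge.
  by rewrite rmorphN mulrN opprK.
have [orthoE orthoE'] : hs_inner (Estring R[i] c) (adjoint (Estring R[i] c)) = 0
    /\ hs_inner (adjoint (Estring R[i] c)) (Estring R[i] c) = 0.
  (* This is where the positivity of [omega c] enters. *)
  rewrite EstringE adjoint_string; apply: string_dual_ortho.
  by rewrite sum_charge lt0r_neq0.
have normE : hs_inner (Estring R[i] c) (Estring R[i] c) = 2 ^+ mdeg c.
  by rewrite EstringE hs_inner_stringxx sum_mdeg.
have normE' : hs_inner (adjoint (Estring R[i] c)) (adjoint (Estring R[i] c))
    = 2 ^+ mdeg c.
  (* Dualising keeps the first bit of each label, so the degree is unchanged. *)
  by rewrite EstringE adjoint_string hs_inner_stringxx -sum_mdeg.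
have [hX hY] := hermsymm_quadratures (Estring R[i] c).
have [adX adY] := ad_quadratures (adE c) adE'.
split=> //; rewrite /hs_norm !sqrtCK.
have norm_i : `|'i^-1 : R[i]| = 1 by rewrite normfV normCi invr1.
split.
  have -> : Xstring R[i] c = 1 *: Estring R[i] c + 1 *: adjoint (Estring R[i] c).
    by rewrite !scale1r.
  (* Both coefficients have modulus 1, so the squared norm is twice [2 ^+ mdeg c]. *)
  rewrite hs_inner_orthoD // normE normE' normr1 expr1n mul1r.
  by rewrite exprS mulr2n mulrDl mul1r.
have -> : Ystring R[i] c
    = 'i^-1 *: Estring R[i] c + (- 'i^-1) *: adjoint (Estring R[i] c).
  by rewrite scaleNr -scalerBr.
rewrite hs_inner_orthoD // normE normE' normrN norm_i expr1n mul1r.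
by rewrite exprS mulr2n mulrDl mul1r.
Qed.
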